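(* Let $m\ge 3$ be odd and let $\mathscr{A}=(a_{i_1\cdots i_m})\in\mathbb{T}_{m,2}$ be the tensor with $$a_{\underbrace{1\cdots 1}_{m-i}\underbrace{2\cdots 2}_{i}}=a_{\underbrace{2\cdots 2}_{i+1}\underbrace{1\cdots 1}_{m-1-i}}=(-1)^i\binom{m-1}{i},\quad \forall i\in\{0,1,\ldots,m-1\},$$ and all other $a_{i_1\cdots i_m}=0$. Then $\mathscr{A}$ is a $Q$-tensor and is semi-positive, but $(1,1)^T$ is a solution to the system $\mathscr{A}x^{m-1}=0$, $x>0$. Consequently, the result that for every semi-monotone $Q$-matrix $A\in\mathbb{R}^{n\times n}$ the system $Ax=0$, $x>0$ is inconsistent cannot be extended to tensors (with semi-positive $Q$-tensors in place of semi-monotone $Q$-matrices and $\mathscr{A}x^{m-1}=0$, $x>0$ in place of $Ax=0$, $x>0$).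
   Context: $[n]=\{1,\ldots,n\}$, $\mathbb{R}^n_+=\{x\in\mathbb{R}^n:x\ge 0\}$; vector inequalities are componentwise. $\mathbb{T}_{m,n}$ is the set of real $m$-order $n$-dimensional tensors $\mathscr{A}=(a_{i_1\cdots i_m})$, $a_{i_1\cdots i_m}\in\mathbb{R}$ for $i_1,\ldots,i_m\in[n]$ (no symmetry assumed). For $x\in\mathbb{R}^n$, $\mathscr{A}x^{m-1}\in\mathbb{R}^n$ is defined by $(\mathscr{A}x^{m-1})_i=\sum_{i_2,\ldots,i_m=1}^n a_{ii_2\cdots i_m}x_{i_2}\cdots x_{i_m}$. For the tensor in the claim, both components of $\mathscr{A}x^{m-1}$ equal $(x_1-x_2)^{m-1}$. $\mathscr{A}$ is a $Q$-tensor if for every $q\in\mathbb{R}^n$ there is $x\in\mathbb{R}^n$ with $x\ge 0$, $\mathscr{A}x^{m-1}+q\ge 0$, $x^T(\mathscr{A}x^{m-1}+q)=0$. $\mathscr{A}$ is semi-positive if for each $x\in\mathbb{R}^n_+\setminus\{0\}$ there is $i\in[n]$ with $x_i>0$ and $(\mathscr{A}x^{m-1})_i\ge 0$. For $m=2$ these are the notions of $Q$-matrix and semi-monotone matrix. *)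

(* Defs.v *)
From HB Require Import structures.
From mathcomp Require Import all_boot all_order all_algebra.
From mathcomp Require Import reals.
Set Implicit Arguments.
Unset Strict Implicit.
Unset Printing Implicit Defensive.
Import Order.TTheory GRing.Theory Num.Theory.
Local Open Scope ring_scope.

Section Definitions.
Variable R : realType.

Definition nonneg n (x : 'cV[R]_n) : Prop := forall i, 0 <= x i 0.
Definition positive n (x : 'cV[R]_n) : Prop := forall i, 0 < x i 0.

Definition tensor (m n : nat) : Type := {ffun m.-tuple 'I_n -> R}.

(* The sum runs over all index tuples (i_1, ..., i_m) whose first entry is i;
   [behead s] is (i_2, ..., i_m). *)
Definition tensor_app m n (A : tensor m n) (x : 'cV[R]_n) : 'cV[R]_n :=
  \col_i \sum_(s : m.-tuple 'I_n | ohead s == Some i)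
            A s * \prod_(j <- behead s) x j 0.

Definition Q_tensor m n (A : tensor m n) : Prop :=
  forall q : 'cV[R]_n, exists x : 'cV[R]_n,
    [/\ nonneg x, nonneg (tensor_app A x + q)
      & x^T *m (tensor_app A x + q) = 0].

Definition semi_positive m n (A : tensor m n) : Prop :=
  forall x : 'cV[R]_n, nonneg x -> x <> 0 ->
    exists i, 0 < x i 0 /\ 0 <= tensor_app A x i 0.

Definition Q_matrix n (A : 'M[R]_n) : Prop :=
  forall q : 'cV[R]_n, exists x : 'cV[R]_n,
    [/\ nonneg x, nonneg (A *m x + q) & x^T *m (A *m x + q) = 0].

Definition semi_monotone n (A : 'M[R]_n) : Prop :=
  forall x : 'cV[R]_n, nonneg x -> x <> 0 ->
    exists i, 0 < x i 0 /\ 0 <= (A *m x) i 0.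

(* The elements 0 and 1 of 'I_2 stand for the indices 1 and 2. *)
Definition index12 m i : seq 'I_2 := nseq (m - i) 0 ++ nseq i 1.
Definition index21 m i : seq 'I_2 := nseq i.+1 1 ++ nseq (m - 1 - i) 0.

(* At most one i satisfies the condition under [pick]: see [example_tensor12]
   and [example_tensor21]. *)
Definition example_entry m (s : seq 'I_2) : R :=
  if [pick i : 'I_m | (s == index12 m i) || (s == index21 m i)] is Some i
  then (-1) ^+ i * ('C(m - 1, i))%:R else 0.

Definition example_tensor m : tensor m 2 :=
  [ffun s : m.-tuple 'I_2 => example_entry m s].

Definition matrix_tensor n (A : 'M[R]_n) : tensor 2 n :=
  [ffun s : 2.-tuple 'I_n => A (tnth s 0) (tnth s 1)].

Lemma tensor_app_matrix n (A : 'M[R]_n) x :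
  tensor_app (matrix_tensor A) x = A *m x.
Proof.
apply/colP => i; rewrite !mxE.
rewrite (reindex_onto (fun j : 'I_n => [tuple i; j]) (fun s => tnth s 1)) /=.
  apply: eq_big => [j|j _]; first by rewrite (tnth_nth i) /= !eqxx.
  by rewrite ffunE !(tnth_nth i) /= big_seq1.
move=> s; case/tupleP: s => a s; case/tupleP: s => b s /=.
by rewrite (tuple0 s) => /eqP[<-]; apply/val_inj; rewrite /= (tnth_nth a).
Qed.

Lemma Q_tensor_matrix n (A : 'M[R]_n) :
  Q_tensor (matrix_tensor A) <-> Q_matrix A.
Proof.
by split=> H q; have [x] := H q;
  rewrite ?tensor_app_matrix => Hx; exists x; rewrite ?tensor_app_matrix.
Qed.

Lemma semi_positive_matrix n (A : 'M[R]_n) :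
  semi_positive (matrix_tensor A) <-> semi_monotone A.
Proof.
by split=> H x x0 xn0; have [i] := H x x0 xn0;
  rewrite ?tensor_app_matrix => Hi; exists i; rewrite ?tensor_app_matrix.
Qed.

Lemma index12_inj m i j :
  (i < m)%N -> (j < m)%N -> index12 m i = index12 m j -> i = j.
Proof.
move=> _ _ /(congr1 (count_mem 1)); rewrite !count_cat !count_nseq /=.
by rewrite !mul0n !mul1n.
Qed.

Lemma index21_inj m i j :
  (i < m)%N -> (j < m)%N -> index21 m i = index21 m j -> i = j.
Proof.
move=> _ _ /(congr1 (count_mem 1)); rewrite !count_cat !count_nseq /=.
by rewrite !mul0n !mul1n !addn0 => -[].
Qed.

Lemma index12_neq21 m i j : (i < m)%N -> index12 m i <> index21 m j.
Proof.
by rewrite -subn_gt0 /index12; case: (m - i)%N => // k _.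
Qed.

Lemma example_tensor12 m (s : m.-tuple 'I_2) i : (i < m)%N ->
  tval s = index12 m i ->
  example_tensor m s = (-1) ^+ i * ('C(m - 1, i))%:R.
Proof.
move=> im Es; rewrite ffunE /example_entry; case: pickP => [j|/(_ (Ordinal im))]; last first.
  by rewrite /= Es eqxx.
rewrite Es => /orP[]/eqP E; first by rewrite -(index12_inj im _ E).
by case: (index12_neq21 im E).
Qed.

Lemma example_tensor21 m (s : m.-tuple 'I_2) i : (i < m)%N ->
  tval s = index21 m i ->
  example_tensor m s = (-1) ^+ i * ('C(m - 1, i))%:R.
Proof.
move=> im Es; rewrite ffunE /example_entry; case: pickP => [j|/(_ (Ordinal im))]; last first.
  by rewrite /= Es eqxx orbT.
rewrite Es => /orP[]/eqP E; last by rewrite -(index21_inj im _ E).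
by case: (index12_neq21 (ltn_ord j) (esym E)).
Qed.

Lemma example_tensor0 m (s : m.-tuple 'I_2) :
  (forall i, (i < m)%N -> tval s <> index12 m i /\ tval s <> index21 m i) ->
  example_tensor m s = 0.
Proof.
move=> H; rewrite ffunE /example_entry; case: pickP => // j.
by have [h1 h2] := H j (ltn_ord j); move=> /orP[]/eqP.
Qed.

End Definitions.

(* Main.v *)
Require Import Defs.
From HB Require Import structures.
From mathcomp Require Import all_boot all_order all_algebra.
From mathcomp Require Import reals.
Import Order.TTheory GRing.Theory Num.Theory.
Local Open Scope ring_scope.

(** By the binomial formula both components of [A x^(m-1)] are the even power
    [(x1 - x2)^(m-1)], whence semi-positivity and the zero [(1, 1)].  If the
    smaller entry [q_i] of [q] is negative, the multiple of the [i]-th unit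
    vector by the [(m-1)]-th root of [- q_i] solves the complementarity problem
    (and [0] solves it otherwise).  For a matrix, the Q-property at
    [q = (-1, ..., -1)] yields [z >= 0] with [A z >= 1]; if also [A x = 0] with
    [x > 0], then [x - e z > 0] and [A (x - e z) < 0] for small [e > 0], which
    contradicts semi-monotonicity. *)

(** Serves to reduce the sum over all index tuples in [tensor_app] to the tuples that carry nonzero
    entries, enumerated by [i]. *)
Lemma sum_injective_image (R : nmodType) (I J : finType) (f : I -> J)
    (P : pred J) (F : J -> R) :
  injective f -> (forall i, P (f i)) ->
  (forall j, P j -> (forall i, j <> f i) -> F j = 0) ->
  \sum_(j | P j) F j = \sum_i F (f i).
Proof.
move=> finj Pf F0; rewrite (bigID [in f @: I]) /= [X in _ + X]big1 ?addr0.
  rewrite -(big_imset (h := f) (A := I) F) /=; last by move=> ? ? _ _; apply: finj.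
  apply: eq_bigl => j; case: imsetP => [[i _ ->]|_]; by rewrite ?Pf ?andbF.
move=> j /andP[Pj njf]; apply: F0 => // i ji.
by rewrite ji imset_f in njf.
Qed.

Lemma size_index12 {m} (i : 'I_m) : size (index12 m i) == m.
Proof. by rewrite size_cat !size_nseq subnK // ltnW. Qed.

Lemma size_index21 {m} (i : 'I_m) : size (index21 m i) == m.
Proof.
by rewrite size_cat !size_nseq -subnDA add1n subnKC.
Qed.

Lemma prod_nseq (R : pzRingType) (I : Type) n (i : I) (x : I -> R) :
  \prod_(j <- nseq n i) x j = x i ^+ n.
Proof. by rewrite big_nseq iter_mulr mulr1. Qed.

(** For [i < m], [index12 m i] starts with 0 and [index21 m i] with 1, so each row meets just one
    family of entries. Dropping the first index leaves [m.-1 - i] zeros and [i] ones in both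
    families, hence the same binomial expansion. *)
Lemma tensor_app_example (R : realType) m (x : 'cV[R]_2) i : (0 < m)%N ->
  tensor_app (example_tensor R m) x i 0 = (x 0 0 - x 1 0) ^+ m.-1.
Proof.
case: m => // k _; rewrite mxE /=.
have {i} [->|->] : i = 0 \/ i = 1.
  by case: i => [[|[]]] // ?; [left|right]; apply/val_inj.
- rewrite (@sum_injective_image _ _ _ (fun i : 'I_k.+1 => Tuple (size_index12 i))).
  + rewrite exprBn; apply: eq_bigr => i _.
    rewrite (@example_tensor12 _ _ _ i) // subn1 /= /index12 subSn -1?ltnS //=.
    by rewrite big_cat !prod_nseq /= mulrAC !mulrA mulr_natr.
  + by move=> i j /(congr1 val) E; apply/val_inj/(index12_inj _ _ E).
  + by move=> i; rewrite /= /index12 subSn -1?ltnS.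
  + move=> s /eqP hs ns; rewrite example_tensor0 ?mul0r // => i ik; split.
      by move=> E; apply: (ns (Ordinal ik)); apply/val_inj.
    by move=> E; move: hs; rewrite E.
- rewrite (@sum_injective_image _ _ _ (fun i : 'I_k.+1 => Tuple (size_index21 i))).
  + rewrite exprBn; apply: eq_bigr => i _.
    rewrite (@example_tensor21 _ _ _ i) // subn1 /= /index21 /=.
    rewrite big_cat !prod_nseq /= subn1 /=.
    by rewrite [x 1 0 ^+ i * _]mulrC mulrAC !mulrA mulr_natr.
  + by move=> i j /(congr1 val) E; apply/val_inj/(index21_inj _ _ E).
  + by [].
  + move=> s /eqP hs ns; rewrite example_tensor0 ?mul0r // => i ik; split.
      by move=> E; move: hs; rewrite E /index12 subSn -1?ltnS.
    by move=> E; apply: (ns (Ordinal ik)); apply/val_inj.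
Qed.

Lemma nonneg_root_exists (R : rcfType) k (c : R) : (0 < k)%N -> 0 <= c ->
  exists2 t, 0 <= t & t ^+ k = c.
Proof.
move=> k0 c0.
(* The right endpoint is [1 + c] because [(1 + c) ^+ k >= 1 + c >= c]; [c] itself would fail for
   [0 < c < 1] and [k > 1]. *)
have c1 : 0 <= 1 + c by rewrite addr_ge0.
have [||t /andP[t0 _] /rootP] := @poly_ivt R ('X^k - c%:P) 0 (1 + c).
- exact: c1.
- rewrite !hornerE expr0n eqn0Ngt k0 sub0r oppr_le0 c0 subr_ge0 /= (@le_trans _ _ (1 + c)) ?lerDr //.
  by rewrite ler_eXnr // lerDl.
- by rewrite !hornerE => /eqP; rewrite subr_eq0 => /eqP; exists t.
Qed.

Lemma example_tensor_Q (R : realType) m : (3 <= m)%N -> odd m ->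
  Q_tensor (example_tensor R m).
Proof.
move=> m3 modd q.
have m0 : (0 < m)%N by apply: leq_trans m3.
have k0 : (0 < m.-1)%N by case: m m3 {modd m0} => [|[]].
have evenk : ~~ odd m.-1 by case: m modd {m3 m0 k0}.
(* For the second unit vector the difference is [- t]; the even exponent absorbs the sign. *)
have sub_pow (i : 'I_2) (t : R) :
    ((t *: delta_mx i 0 : 'cV[R]_2) 0 0 - (t *: delta_mx i 0 : 'cV[R]_2) 1 0)
      ^+ m.-1 = t ^+ m.-1.
  case: i => [[|[]]] // ?; rewrite !mxE /= ?mulr1 ?mulr0 ?subr0 //.
  by rewrite sub0r exprNn -signr_odd (negbTE evenk) mul1r.
pose i := [arg min_(j < 0 : 'I_2) q j 0]%O.
have q_min j : q i 0 <= q j 0 by rewrite /i; case: arg_minP => //= ? _; apply.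
have [qi0|qi0] := leP 0 (q i 0).
  exists 0; split; last by rewrite trmx0 mul0mx.
    by move=> j; rewrite mxE.
  move=> j; rewrite mxE tensor_app_example // !mxE subrr expr0n.
  by rewrite addr_ge0 ?ler0n // (le_trans qi0).
have [t t0 tq] : exists2 t, 0 <= t & t ^+ m.-1 = - q i 0.
  by apply: nonneg_root_exists; rewrite // oppr_ge0 ltW.
exists (t *: delta_mx i 0); split.
- by move=> j; rewrite !mxE mulr_ge0 ?ler0n.
(* Component [j] is [q j 0 - q i 0]: nonnegative by minimality, and zero at [i], the support of the
   solution. *)
- by move=> j; rewrite mxE tensor_app_example // sub_pow tq addrC subr_ge0.
- apply/matrixP => a b; rewrite !ord1 linearZ /= trmx_delta -scalemxAl -rowE.
  rewrite 3!mxE tensor_app_example // sub_pow tq addNr mulr0.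
  by rewrite mxE.
Qed.

Lemma example_tensor_semi_positive (R : realType) m : odd m ->
  semi_positive (example_tensor R m).
Proof.
move=> modd x x0 xn0.
have m0 : (0 < m)%N by apply: odd_gt0.
have [i xi|xle] := pickP (fun i => 0 < x i 0).
  exists i; split => //; rewrite tensor_app_example //.
  by apply: exprn_even_ge0; case: m modd {m0}.
case: xn0; apply/colP => i; rewrite mxE; apply/eqP.
by rewrite eq_le x0 leNgt xle.
Qed.

Lemma semi_monotone_Q_matrix_inconsistent (R : realType) n (A : 'M[R]_n) :
  (0 < n)%N -> semi_monotone A -> Q_matrix A ->
  ~ (exists x : 'cV[R]_n, A *m x = 0 /\ positive x).
Proof.
move=> n0 smA QA [x [Ax0 x_gt0]].
have [z [z0 Azq _]] := QA (const_mx (-1)).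
have Az i : 0 < (A *m z) i 0.
  by have := Azq i; rewrite mxE [const_mx _ _ _]mxE subr_ge0; apply: lt_le_trans.
have [e e0 ex] : exists2 e : R, 0 < e & forall i, e * z i 0 < x i 0.
  have z1 i : 0 < 1 + z i 0 by rewrite ltr_pwDl.
  (* With [e] the least ratio, [e * z i 0 < e * (1 + z i 0) <= x i 0]; the added 1 covers
     [z i 0 = 0] and makes the bound strict. *)
  pose r i := x i 0 / (1 + z i 0).
  pose i0 := [arg min_(j < Ordinal n0) r j]%O.
  have r_min j : r i0 <= r j by rewrite /i0; case: arg_minP => //= ? _; apply.
  have r0 : 0 < r i0 by rewrite divr_gt0.
  exists (r i0) => // i; apply: (@lt_le_trans _ _ (r i0 * (1 + z i 0))).
    by rewrite ltr_pM2l // ltrDr.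
  by rewrite -ler_pdivlMr //; apply: r_min.
pose y := x - e *: z.
have y0 i : 0 < y i 0 by rewrite !mxE subr_gt0.
have [|i [_]] := smA y (fun i => ltW (y0 i)).
  by move=> E; have := y0 (Ordinal n0); rewrite E mxE ltxx.
rewrite mulmxBr Ax0 sub0r -scalemxAr 2!mxE oppr_ge0 leNgt.
by rewrite mulr_gt0.
Qed.

(* In the last two clauses n = 0 is excluded because every condition on
   0-dimensional tensors is vacuous. *)
Theorem mainTheorem5 (R : realType) (m : nat) (hm : (3 <= m)%N) (hodd : odd m) :
  Q_tensor (example_tensor R m) /\
  semi_positive (example_tensor R m) /\
  (tensor_app (example_tensor R m) (const_mx 1) = 0 /\
   positive (const_mx 1 : 'cV[R]_2)) /\
  (forall n : nat, (0 < n)%N -> forall A : 'M[R]_n,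
     semi_monotone A -> Q_matrix A ->
     ~ (exists x : 'cV[R]_n, A *m x = 0 /\ positive x)) /\
  ~ (forall n : nat, (0 < n)%N -> forall A : tensor R m n,
       semi_positive A -> Q_tensor A ->
       ~ (exists x : 'cV[R]_n, tensor_app A x = 0 /\ positive x)).
Proof.
have QA := example_tensor_Q R m hm hodd.
have spA := example_tensor_semi_positive R m hodd.
have app1 : tensor_app (example_tensor R m) (const_mx 1) = 0.
  apply/colP => i; rewrite tensor_app_example ?odd_gt0 // !mxE subrr.
  by rewrite expr0n; case: m hm {hodd QA spA} => [|[]].
have pos1 : positive (const_mx 1 : 'cV[R]_2) by move=> i; rewrite mxE.
split; [exact: QA | split; [exact: spA | split; [by [] | split]]].
  by move=> n n0 A; apply: semi_monotone_Q_matrix_inconsistent.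
by move=> H; apply: (H 2 isT _ spA QA); exists (const_mx 1).
Qed.
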